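(* Let $\mathbb K$ be a field of characteristic $0$, $\ell\ge2$, and let $(g;f_1,\ldots,f_\ell)=(d_{n,k})_{n\ge k\ge0}$ be an $\ell$-multiple Riordan array over $\mathbb K$, with compression $(\hat d_{n,k})_{n\ge k\ge0}$, $\hat d_{n,k}=d_{n\ell-(\ell-1)k,\,k}$. Let its $A$-sequence be $(a_0,a_1,\ldots)$ and its $Z_i$-sequences be $(z_{i,0},z_{i,1},\ldots)$, $i=0,1,\ldots,\ell-1$, with generating functions $A(t)=\sum_{k\ge0}a_kt^{\ell k}$ and $Z_i(t)=\sum_{k\ge0}z_{i,k}t^{\ell k}$. Then $$A\left(\sqrt[\ell]{\frac{\hat f_1\hat f_2\cdots\hat f_\ell}{t^{\ell-1}}}\right)=\frac{\hat f_1\hat f_2\cdots\hat f_\ell}{t^\ell},\qquad Z_0\left(\sqrt[\ell]{\frac{\hat f_1\hat f_2\cdots\hat f_\ell}{t^{\ell-1}}}\right)=\frac1t\left(1-\frac{g_0}{\hat g(t)}\right),$$ and for $m=1,2,\ldots,\ell-1$, $$Z_m\left(\sqrt[\ell]{\frac{\hat f_1\hat f_2\cdots\hat f_\ell}{t^{\ell-1}}}\right)=\frac1t\left(1-\frac{g_0f_{1,1}f_{2,1}\cdots f_{m,1}t^m}{\hat g\hat f_1\hat f_2\cdots\hat f_m}\right),$$ where $g_0=[t^0]g$ and $f_{i,1}=[t]f_i$; or equivalently, $$\hat d_{n,k}=\sum_{j\ge0}a_j\,\hat d_{n-\ell+j(\ell-1),\,k+(j-1)\ell}\qquad\text{for }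 n\ge k\ge\ell,$$ $$\hat d_{n,m}=\sum_{j\ge0}z_{m,j}\,\hat d_{n-1+j(\ell-1),\,m+j\ell}\qquad\text{for } m=0,1,\ldots,\ell-1,\ n\ge m+1.$$
   Context: An $\ell$-multiple Riordan array $(g;f_1,\ldots,f_\ell)$ is given by $g\in\mathbb K[[t^\ell]]$ with $g(0)\neq0$ and $f_i\in t\,\mathbb K[[t^\ell]]$ with $[t]f_i\ne0$; its entries are $$d_{n,k}=[t^n]\,g\,f_1^{\lfloor (k+\ell-1)/\ell\rfloor}f_2^{\lfloor (k+\ell-2)/\ell\rfloor}\cdots f_\ell^{\lfloor k/\ell\rfloor}.$$ The $A$-sequence $(a_j)$ is the unique sequence with $d_{n,k}=\sum_{j\ge0}a_j\,d_{n-\ell,\,k+(j-1)\ell}$ for all $n,k\ge\ell$. For $m=0,\ldots,\ell-1$, the $Z_m$-sequence $(z_{m,j})_j$ is the unique sequence with $d_{n,m}=\sum_{j\ge0}z_{m,j}\,d_{n-\ell,\,m+j\ell}$ for all $n\ge m+1$ (entries with negative row index are $0$). The series $\hat g,\hat f_i\in\mathbb K[[t]]$ are defined by $\hat g(t^\ell)=g(t)$ and $\hat f_i(t^\ell)=t^{\ell-1}f_i(t)$; i.e. if $g=\sum_k g^{(k)}t^{k\ell}$ and $f_i=\sum_k f_i^{(k)}t^{k\ell+1}$, then $\hat g=\sum_k g^{(k)}t^k$ and $\hat f_i=\sum_k f_i^{(k)}t^{k+1}$. Since $A$ and the $Z_i$ are power series in $t^\ell$, for a series $X$ with $X(0)=0$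 the expressions $A(\sqrt[\ell]{X})$ and $Z_i(\sqrt[\ell]{X})$ mean $\sum_k a_kX^k$ and $\sum_k z_{i,k}X^k$. In the recurrences for $\hat d$, $\hat d_{n,k}=0$ whenever $k>n$, so the sums are finite. *)

(* Defs.v *)
From HB Require Import structures.
From mathcomp Require Import all_boot all_order all_algebra.
From mathcomp Require Import boolp classical_sets fsbigop.

Set Implicit Arguments.
Unset Strict Implicit.
Unset Printing Implicit Defensive.

Import GRing.Theory.

Local Open Scope ring_scope.

(** * The integral domain K[[t]] *)

(** A series coerces to its coefficient function, so [s n] is [t^n] s. *)
Record fps (K : fieldType) := Fps { coefs :> nat -> K }.

Section FpsRing.
Variable K : fieldType.
Implicit Types p q r : fps K.

Lemma fpsP p q : p =1 q <-> p = q.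
Proof.
split=> [|->//]; case: p q => [p] [q] /= e; congr Fps; exact: funext.
Qed.

HB.instance Definition _ := gen_eqMixin (fps K).
HB.instance Definition _ := gen_choiceMixin (fps K).

Definition fps_zero : fps K := Fps (fun=> 0).
Definition fps_opp p : fps K := Fps (fun n => - p n).
Definition fps_add p q : fps K := Fps (fun n => p n + q n).

Fact fps_addA : associative fps_add.
Proof. by move=> p q r; apply/fpsP => n /=; rewrite addrA. Qed.
Fact fps_addC : commutative fps_add.
Proof. by move=> p q; apply/fpsP => n /=; rewrite addrC. Qed.
Fact fps_add0 : left_id fps_zero fps_add.
Proof. by move=> p; apply/fpsP => n /=; rewrite add0r. Qed.
Fact fps_addN : left_inverse fps_zero fps_opp fps_add.
Proof. by move=> p; apply/fpsP => n /=; rewrite addNr. Qed.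

HB.instance Definition _ :=
  GRing.isZmodule.Build (fps K) fps_addA fps_addC fps_add0 fps_addN.

Definition fpsC (c : K) : fps K := Fps (fun n => if n is 0 then c else 0).
Definition fps_mul p q : fps K :=
  Fps (fun n => \sum_(i < n.+1) p i * q (n - i)%N).

Lemma fps_mul_rev p q n :
  fps_mul p q n = \sum_(i < n.+1) p (n - i)%N * q i.
Proof.
rewrite /= (reindex_inj rev_ord_inj) /=.
by apply: eq_bigr => j _; rewrite (sub_ordK j).
Qed.

Fact fps_mulA : associative fps_mul.
Proof.
move=> p q r; apply/fpsP => i; rewrite [RHS]fps_mul_rev.
pose coef3 j k := p j * (q (i - j - k)%N * r k).
transitivity (\sum_(j < i.+1) \sum_(k < i.+1 | (k <= i - j)%N) coef3 j k).
  apply: eq_bigr => j _; rewrite fps_mul_rev big_distrr /=.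
  by rewrite (big_ord_narrow_leq (leq_subr _ _)).
rewrite (exchange_big_dep predT) //=; apply: eq_bigr => k _.
transitivity (\sum_(j < i.+1 | (j <= i - k)%N) coef3 j k).
  apply: eq_bigl => j; rewrite -ltnS -(ltnS j) -!subSn ?leq_ord //.
  by rewrite -subn_gt0 -(subn_gt0 j) -!subnDA addnC.
rewrite (big_ord_narrow_leq (leq_subr _ _)) big_distrl /=.
by apply: eq_bigr => j _; rewrite /coef3 -!subnDA addnC mulrA.
Qed.

Fact fps_mulC : commutative fps_mul.
Proof.
move=> p q; apply/fpsP => n; rewrite fps_mul_rev.
by apply: eq_bigr => i _; rewrite mulrC.
Qed.

Fact fps_mul1 : left_id (fpsC 1) fps_mul.
Proof.
move=> p; apply/fpsP => n /=; rewrite big_ord_recl /= mul1r subn0.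
by rewrite big1 ?addr0 // => i _; rewrite mul0r.
Qed.

Fact fps_mulDl : left_distributive fps_mul fps_add.
Proof.
move=> p q r; apply/fpsP => n /=; rewrite -big_split /=.
by apply: eq_bigr => i _; rewrite mulrDl.
Qed.

Fact fps_1neq0 : fpsC 1 != 0 :> fps K.
Proof. by apply/eqP => /fpsP /(_ 0%N) /= /eqP; rewrite oner_eq0. Qed.

HB.instance Definition _ := GRing.Zmodule_isComNzRing.Build (fps K)
  fps_mulA fps_mulC fps_mul1 fps_mulDl fps_1neq0.

Lemma fps0E n : (0 : fps K) n = 0. Proof. by []. Qed.
Lemma fps1E n : (1 : fps K) n = (n == 0%N)%:R. Proof. by case: n. Qed.
Lemma fpsDE p q n : (p + q) n = p n + q n. Proof. by []. Qed.
Lemma fpsNE p n : (- p) n = - p n. Proof. by []. Qed.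
Lemma fpsME p q n : (p * q) n = \sum_(i < n.+1) p i * q (n - i)%N.
Proof. by []. Qed.
Lemma fps_sumE I (s : seq I) (P : pred I) (F : I -> fps K) n :
  (\sum_(i <- s | P i) F i) n = \sum_(i <- s | P i) F i n.
Proof. exact: (big_morph (fun p : fps K => p n)). Qed.
Lemma fpsM0E p q : (p * q) 0%N = p 0%N * q 0%N.
Proof. by rewrite fpsME big_ord1. Qed.

(** [p] has order at least [k]. *)
Definition fps_lead0 k p := forall n, (n < k)%N -> p n = 0.

Lemma fps_lead0M k1 k2 p q :
  fps_lead0 k1 p -> fps_lead0 k2 q -> fps_lead0 (k1 + k2) (p * q).
Proof.
move=> hp hq n ltn; rewrite fpsME big1 // => i _.
have [/hp ->|le_k1] := ltnP i k1; first by rewrite mul0r.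
rewrite hq ?mulr0 //.
have [lein|/ltnW] := leqP i n; first by rewrite ltn_subLR // (leq_trans ltn) ?leq_add2r.
rewrite -subn_eq0 => /eqP ->; apply: contraTltn ltn; rewrite leqn0 => /eqP ->.
by rewrite addn0 -leqNgt (leq_trans _ (leq_ord i)).
Qed.

Lemma fps_lead0X p k : p 0%N = 0 -> fps_lead0 k (p ^+ k).
Proof.
move=> p0; elim: k => [|k IHk] //; rewrite exprS -addn1 addnC.
by apply: fps_lead0M => // -[].
Qed.

Lemma fps_mul_lead i j p q : fps_lead0 i p -> fps_lead0 j q ->
  (p * q) (i + j)%N = p i * q j.
Proof.
move=> hp hq; have lti : (i < (i + j).+1)%N by rewrite ltnS leq_addr.
rewrite fpsME (bigD1 (Ordinal lti)) //= addKn big1 ?addr0 // => k ki.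
have [/hp ->|leik] := ltnP k i; first by rewrite mul0r.
rewrite hq ?mulr0 // ltn_subLR ?leq_ord // ltn_add2r ltn_neqAle leik andbT.
by rewrite eq_sym.
Qed.

(** The inverse of a series with constant term [c != 0] is the geometric series
    c^-1 (1 + u + u^2 + ...) with u = 1 - c^-1 p; since u has order at least 1,
    only u^0, ..., u^n contribute to the coefficient of t^n. *)
Definition fps_unit : pred (fps K) := fun p => p 0%N != 0.
Definition fps_geom p : fps K :=
  let c' := fpsC (p 0%N)^-1 in
  Fps (fun n => (c' * \sum_(j < n.+1) (1 - c' * p) ^+ j) n).
Definition fps_inv p : fps K := if fps_unit p then fps_geom p else p.

Fact fps_mulV : {in fps_unit, left_inverse 1 fps_inv *%R}.
Proof.
move=> p; rewrite unfold_in => p0; rewrite /fps_inv /fps_unit p0; apply/fpsP => n.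
set c' := fpsC (p 0%N)^-1; set u := 1 - c' * p.
have u0 : u 0%N = 0 by rewrite fpsDE fpsNE fpsM0E /= mulVf // subrr.
have gE m : fps_geom p m = (c' * \sum_(j < m.+1) u ^+ j) m by [].
transitivity ((c' * (\sum_(j < n.+1) u ^+ j) * p) n).
  rewrite !fpsME; apply: eq_bigr => i _; congr (_ * _).
  rewrite gE !fpsME; apply: eq_bigr => k _; congr (_ * _).
  rewrite !fps_sumE [RHS](bigID (fun j : 'I_n.+1 => (j < i.+1)%N)) /=.
  rewrite [X in _ + X]big1 ?addr0; last first.
    move=> j; rewrite -leqNgt => ltij; apply: fps_lead0X => //.
    by rewrite (leq_ltn_trans (leq_subr _ _)).
  by rewrite (big_ord_narrow_leq (leq_ord i)).
have -> : c' * (\sum_(j < n.+1) u ^+ j) * p = 1 - u ^+ n.+1.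
  rewrite mulrAC -[1 in RHS](expr1n _ n.+1) subrXX.
  rewrite {2}/u opprB addrCA subrr addr0; congr (_ * _).
  by apply: eq_bigr => i _; rewrite expr1n mul1r.
by rewrite fpsDE fpsNE fps_lead0X // subr0.
Qed.

Fact fps_unitP p q : q * p = 1 -> fps_unit p.
Proof.
move=> /fpsP /(_ 0%N); rewrite fpsM0E => /eqP qp.
by apply: contraTneq qp => ->; rewrite mulr0 eq_sym oner_eq0.
Qed.

Fact fps_inv_out : {in [predC fps_unit], fps_inv =1 id}.
Proof. by move=> p; rewrite inE unfold_in /fps_inv /fps_unit => /negbTE ->. Qed.

HB.instance Definition _ :=
  GRing.ComNzRing_hasMulInverse.Build (fps K) fps_mulV fps_unitP fps_inv_out.

Lemma fps_ord p : p != 0 -> exists2 k, p k != 0 & fps_lead0 k p.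
Proof.
move=> p0; have exk : exists k, p k != 0.
  apply: contra_notP (negP p0) => h; apply/eqP/fpsP => n.
  by apply: contra_notP h => /eqP; exists n.
case: (ex_minnP exk) => k pk mink; exists k => // n ltnk.
by apply: contraTeq ltnk => /mink; rewrite -leqNgt.
Qed.

Fact fps_integral (p q : fps K) : p * q = 0 -> (p == 0) || (q == 0).
Proof.
move=> pq; apply/norP => -[/fps_ord[i pi hi] /fps_ord[j qj hj]].
move: (fps_mul_lead hi hj); rewrite pq => /esym/eqP.
by rewrite mulf_eq0 (negbTE pi) (negbTE qj).
Qed.

HB.instance Definition _ :=
  GRing.ComUnitRing_isIntegral.Build (fps K) fps_integral.

Definition fpsX : fps K := Fps (fun n => (n == 1)%N%:R).

End FpsRing.

Arguments fpsX {K}.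

Notation "s %:F" := (@FracField.tofrac _ s) : ring_scope.

(** * Multiple Riordan arrays *)

Section MultipleRiordan.
Variables (K : fieldType) (l : nat).
Implicit Types (s X : fps K) (d : nat -> nat -> K) (a : nat -> K).

(** s \in K[[t^l]] and s \in t K[[t^l]], for l >= 2. *)
Definition in_Ktl s := forall n, ~~ (l %| n)%N -> s n = 0.
Definition in_tKtl s := forall n, (n != 1 %[mod l])%N -> s n = 0.

(** The generators f_1, ..., f_l are indexed from 0: [f i] is f_(i+1). *)
Definition multiple_Riordan (g : fps K) (f : 'I_l -> fps K) :=
  [/\ in_Ktl g, g 0%N != 0 & forall i, in_tKtl (f i) /\ f i 1%N != 0].

Definition Riordan_entry (g : fps K) (f : 'I_l -> fps K) (n k : nat) : K :=
  (g * \prod_(i < l) f i ^+ ((k + l - i.+1) %/ l)) n.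

(** The sums over all j : nat below are finitely supported as soon as
    d n k = 0 for k > n, which holds for [Riordan_entry] and [compression]. *)
Definition A_sequence d a :=
  forall n k, (l <= n)%N -> (l <= k)%N ->
    d n k = \sum_(j \in [set: nat]) a j * d (n - l)%N (k + j * l - l)%N.

Definition Z_sequence d (m : nat) (z : nat -> K) :=
  forall n, (m < n)%N ->
    d n m = \sum_(j \in [set: nat])
              z j * (if (l <= n)%N then d (n - l)%N (m + j * l)%N else 0).

Definition compression d (n k : nat) : K :=
  if (k <= n)%N then d (n * l - (l - 1) * k)%N k else 0.

Definition hat_g s : fps K := Fps (fun n => s (n * l)%N).
Definition hat_f s : fps K :=
  Fps (fun n => if n is n'.+1 then s (n' * l).+1 else 0).

Definition fps_dilate s : fps K :=
  Fps (fun n => if (l %| n)%N then s (n %/ l)%N else 0).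

Lemma hat_gE s : in_Ktl s -> fps_dilate (hat_g s) = s.
Proof.
move=> hs; apply/fpsP => n /=; case: ifPn => [ln|/hs ->//].
by rewrite divnK.
Qed.

Lemma fpsXnME s k n :
  (fpsX ^+ k * s) n = if (k <= n)%N then s (n - k)%N else 0.
Proof.
elim: k n => [|k IHk] n; first by rewrite mul1r subn0.
rewrite exprS -mulrA fpsME big_ord_recl [X in X + _]mul0r add0r.
case: n => [|n]; first by rewrite big_ord0.
rewrite big_ord_recl big1 ?addr0 => [|i _]; last exact: mul0r.
by rewrite [LHS]mul1r lift0 subn1 IHk subSS ltnS.
Qed.

Lemma hat_fE s : (1 < l)%N -> in_tKtl s ->
  fps_dilate (hat_f s) = fpsX ^+ (l - 1) * s.
Proof.
move=> l1 hs; have l0 := ltnW l1; apply/fpsP => n; rewrite fpsXnME /=.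
case: ifPn => [/dvdnP[[|q] ->]|ndvd].
- by rewrite mul0n div0n leqNgt subn_gt0 l1.
- rewrite mulnK // ifT; first by rewrite mulSn subnBA // -addnA addKn addn1.
  by rewrite mulSn (leq_trans (leq_subr _ _)) ?leq_addr.
case: ifP => // len; rewrite hs //; apply: contra ndvd => /eqP e.
have : (n = 0 %[mod l])%N.
  by rewrite -(subnK len) -modnDml e modnDml subnKC // modnn mod0n.
by rewrite mod0n => /eqP.
Qed.

(** The generating function sum_k a_k t^(l k). *)
Definition lgf a : fps K := fps_dilate (Fps a).

(** S(X^(1/l)) = sum_k [t^(l k)] S X^k for S in K[[t^l]] and X(0) = 0; then X^k
    has order at least k, so k <= n suffices for the coefficient of t^n. *)
Definition subst_root (S X : fps K) : fps K :=
  Fps (fun n => \sum_(k < n.+1) S (l * k)%N * (X ^+ k) n).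

(** Quotients are taken in the fraction field of K[[t]]; [X] is the series
    whose l-th root is substituted. *)
Definition gf_identities (g : fps K) (f : 'I_l -> fps K)
    (a : nat -> K) (z : nat -> nat -> K) : Prop :=
  let t : {fraction fps K} := fpsX%:F in
  let hg : {fraction fps K} := (hat_g g)%:F in
  let hf i : {fraction fps K} := (hat_f (f i))%:F in
  exists X : fps K,
  [/\ X 0%N = 0,
      X%:F = (\prod_(i < l) hf i) / t ^+ (l - 1),
      (subst_root (lgf a) X)%:F = (\prod_(i < l) hf i) / t ^+ l,
      (subst_root (lgf (z 0%N)) X)%:F
        = t^-1 * (1 - (fpsC (g 0%N))%:F / hg)
    & forall m, (0 < m < l)%N ->
      (subst_root (lgf (z m)) X)%:F
        = t^-1 * (1 - (fpsC (g 0%N * \prod_(i < l | (i < m)%N) f i 1%N))%:F * t ^+ m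
                      / (hg * \prod_(i < l | (i < m)%N) hf i))].

Definition compression_recurrences (g : fps K) (f : 'I_l -> fps K)
    (a : nat -> K) (z : nat -> nat -> K) : Prop :=
  let dh := compression (Riordan_entry g f) in
  (forall n k, (l <= k)%N -> (k <= n)%N ->
     dh n k = \sum_(j \in [set: nat])
                a j * dh (n - l + j * (l - 1))%N (k + j * l - l)%N)
  /\
  (forall m n, (m < l)%N -> (m < n)%N ->
     dh n m = \sum_(j \in [set: nat])
                z m j * dh (n - 1 + j * (l - 1))%N (m + j * l)%N).

End MultipleRiordan.

(* Main.v *)
(** Dilating [t] to [t^l] is an injective ring morphism sending [hat_g] to [g]
    and [hat_f i] to [t^(l-1) f_i]; hence the compression is the array whose
    column [k] is [C_k = hat_g * prod_i (hat_f i)^(e_i(k))] with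
    [sum_i e_i(k) = k].  Put [H = prod_i hat_f i = t^(l-1) X].  As
    [C_(k + j l) = H^j C_k = t^((l-1) j) X^j C_k], the right-hand side of a
    compressed recurrence is a coefficient of [A(X) C_k], resp. [Z_m(X) C_m], so
    the recurrences say [H C_k = t^l A(X) C_k] and
    [C_m - c_m t^m = t Z_m(X) C_m], with [c_m] the leading coefficient
    of [C_m].  The recurrences of [a] and [z] are those of the original array
    at row [n l - (l-1) k], term by term. *)
Require Import Defs.
From mathcomp Require Import all_boot all_order all_algebra.
From mathcomp Require Import boolp classical_sets fsbigop.
From mathcomp Require Import zify ring.

Set Implicit Arguments.
Unset Strict Implicit.
Unset Printing Implicit Defensive.

Import GRing.Theory.

Local Open Scope ring_scope.

Lemma fsbig_nat_ord (V : nmodType) (F : nat -> V) n :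
  (forall j, (n <= j)%N -> F j = 0) ->
  \sum_(j \in [set: nat]) F j = \sum_(j < n) F j.
Proof.
move=> F0; rewrite (fsbigE (iota 0 n)) ?iota_uniq //; last first.
  by move=> i _; rewrite mem_iota /= -leqNgt => /F0.
rewrite -(big_mkord xpredT) /index_iota subn0.
by apply: eq_bigl => i; rewrite in_setT.
Qed.

(** * Powers of [t], constant terms, and clearing denominators *)

Section Fps.
Variable K : fieldType.
Implicit Types (p q : fps K).

Definition fps_shift p : fps K := Fps (fun n => p n.+1).

Lemma fps_shiftE p : p 0%N = 0 -> p = fpsX * fps_shift p.
Proof.
move=> p0; apply/fpsP => n; rewrite -[fpsX]expr1 fpsXnME.
by case: n => [|n] //=; rewrite subn1.
Qed.

Lemma fpsXn_lead0 k p : fps_lead0 k (fpsX ^+ k * p).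
Proof. by move=> n; rewrite fpsXnME ltnNge => /negbTE ->. Qed.

Lemma fpsX_neq0 : (fpsX : fps K) != 0.
Proof. by apply/eqP => /fpsP/(_ 1%N)/eqP; rewrite oner_eq0. Qed.

Lemma fpsCXnE (c : K) m n : (fpsC c * fpsX ^+ m) n = if n == m then c else 0.
Proof.
rewrite mulrC fpsXnME /=; have [->|nm] := eqVneq n m; first by rewrite leqnn subnn.
by case: leqP => // mn; case E: (n - m)%N => //; exfalso; lia.
Qed.

Lemma fps_prod0E I (s : seq I) (P : pred I) (F : I -> fps K) :
  (\prod_(i <- s | P i) F i) 0%N = \prod_(i <- s | P i) F i 0%N.
Proof. by apply: (big_morph (fun p : fps K => p 0%N)) => // p q; exact: fpsM0E. Qed.

Lemma fps_exp0E p n : (p ^+ n) 0%N = p 0%N ^+ n.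
Proof. by elim: n => [//|n IHn]; rewrite !exprS fpsM0E IHn. Qed.

Lemma tofrac_eq_div (R : idomainType) (p q r : R) : r != 0 ->
  p%:F = q%:F / r%:F <-> p * r = q.
Proof.
move=> r0; have rF0 : r%:F != 0 by rewrite tofrac_eq0.
split=> [e|<-]; last by rewrite tofracM mulfK.
by apply/eqP; rewrite -tofrac_eq tofracM e divfK.
Qed.

(** Clears denominators in the shape shared by the identities for all the [Z_m]. *)
Lemma tofrac_eq_mulV_subr_div (R : idomainType) (p x y c : R) :
  x != 0 -> y != 0 ->
  p%:F = x%:F^-1 * (1 - c%:F / y%:F) <-> p * (x * y) = y - c.
Proof.
move=> x0 y0; rewrite -(tofrac_eq_div _ _ (mulf_neq0 x0 y0)) tofracB tofracM.
suff -> : (y%:F - c%:F) / (x%:F * y%:F) = x%:F^-1 * (1 - c%:F / y%:F) by [].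
by rewrite invfM mulrCA mulrBl mulfV ?tofrac_eq0.
Qed.

End Fps.

(** * Dilation of [t] to [t^l], and substitution into series in [t^l] *)

Section Dilate.
Variables (K : fieldType) (l : nat).
Hypothesis l_gt0 : (0 < l)%N.
Implicit Types (p q : fps K).

Lemma fps_dilateE p n :
  fps_dilate l p n = if (l %| n)%N then p (n %/ l)%N else 0.
Proof. by []. Qed.

Lemma fps_dilate1 : fps_dilate l (1 : fps K) = 1.
Proof.
apply/fpsP => n; rewrite fps_dilateE !fps1E; case: ifPn => [/dvdnP[q ->]|].
  by rewrite mulnK // muln_eq0 (gtn_eqF l_gt0) orbF.
by case: n => //; rewrite dvdn0.
Qed.

(** In the Cauchy product only indices divisible by [l] survive; writing them as [j * l] recovers
    the undilated product. *)
Lemma fps_dilateM p q : fps_dilate l (p * q) = fps_dilate l p * fps_dilate l q.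
Proof.
apply/fpsP => n; rewrite fps_dilateE [in RHS]fpsME; case: ifPn => [/dvdnP[m ->]|ndvd]; last first.
  apply/esym/big1 => i _ /=; case: ifP => [li|]; last by rewrite mul0r.
  case: ifP => [lni|]; last by rewrite mulr0.
  by case/negP: ndvd; have := dvdn_add lni li; rewrite subnK // leq_ord.
rewrite mulnK // (bigID (fun i : 'I_(m * l).+1 => l %| i)%N) /= [X in _ + X]big1 ?addr0; last first.
  by move=> i /negbTE ->; rewrite mul0r.
have inP (j : 'I_m.+1) : (j * l < (m * l).+1)%N by rewrite ltnS leq_mul2r leq_ord orbT.
rewrite (reindex_onto (fun j : 'I_m.+1 => Ordinal (inP j))
                      (fun i : 'I_(m * l).+1 => inord (i %/ l))) /=.
  apply: eq_big => [j|j _]; last by rewrite dvdn_mull // -mulnBl dvdn_mull // !mulnK.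
  by rewrite dvdn_mull // -val_eqE /= inordK mulnK ?eqxx ?ltn_ord.
move=> i li; apply: val_inj => /=; rewrite inordK ?divnK //.
by rewrite ltnS leq_divLR // leq_ord.
Qed.

Lemma fps_dilateX p n : fps_dilate l (p ^+ n) = fps_dilate l p ^+ n.
Proof.
by elim: n => [|n IHn]; rewrite ?fps_dilate1 // !exprS fps_dilateM IHn.
Qed.

Lemma fps_dilate_prod I (s : seq I) (P : pred I) (F : I -> fps K) :
  fps_dilate l (\prod_(i <- s | P i) F i) = \prod_(i <- s | P i) fps_dilate l (F i).
Proof. by apply: big_morph; [exact: fps_dilateM | exact: fps_dilate1]. Qed.

(** After exchanging the sums only the cutoffs differ: [X ^+ j] has order at least [j], so terms
    with [j > i] do not affect the coefficient of [t^i]. *)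
Lemma subst_root_mulE (b : nat -> K) (X h : fps K) n : X 0%N = 0 ->
  (subst_root l (lgf l b) X * h) n = \sum_(j \in [set: nat]) b j * (X ^+ j * h) n.
Proof.
move=> X0; rewrite (@fsbig_nat_ord _ _ n.+1); last first.
  move=> j nj; suff -> : (X ^+ j * h) n = 0 by rewrite mulr0.
  by rewrite (fps_shiftE X0) exprMn -mulrA; apply: fpsXn_lead0.
under [RHS]eq_bigr => j _ do rewrite fpsME big_distrr /=.
rewrite exchange_big fpsME /=; apply: eq_bigr => i _.
under eq_bigr => j _ do rewrite dvdn_mulr // mulKn //.
rewrite big_distrl /= [RHS](bigID (fun j : 'I_n.+1 => (j < i.+1)%N)) /=.
rewrite [X in _ = _ + X]big1 ?addr0; last first.
  by move=> j; rewrite -leqNgt => ij; rewrite (fps_lead0X X0) // mul0r mulr0.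
rewrite (big_ord_narrow_leq (leq_ord i)).
by apply: eq_bigr => j _; rewrite mulrA.
Qed.

End Dilate.

(** * Column generating functions and their exponents *)

Section Column.
Variables (K : fieldType) (l : nat).
Hypothesis l_gt0 : (0 < l)%N.
Implicit Types (g c : fps K) (f : 'I_l -> fps K).

(** The exponent is the ceiling of [(k - i) / l], with [i] counted from 0. *)
Definition Riordan_col g f k : fps K :=
  g * \prod_(i < l) f i ^+ ((k + l - i.+1) %/ l).

Lemma ceil_divD k j (i : 'I_l) :
  ((k + j * l + l - i.+1) %/ l = j + (k + l - i.+1) %/ l)%N.
Proof.
have il := ltn_ord i.
by rewrite -divnMDl //; congr (_ %/ _)%N; lia.
Qed.

Lemma ceil_div_small m (i : 'I_l) : (m < l)%N ->
  ((m + l - i.+1) %/ l = (i < m))%N.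
Proof.
move=> ml; have il := ltn_ord i; case: ltnP => im; last by rewrite divn_small //; lia.
have -> : (m + l - i.+1 = 1 * l + (m - i.+1))%N by lia.
by rewrite divnMDl // divn_small //; lia.
Qed.

(** With [k = q l + r] and [r < l], each exponent is [q], plus 1 for the [r] indices [i < r]. *)
Lemma sum_ceil_div k : (\sum_(i < l) (k + l - i.+1) %/ l = k)%N.
Proof.
rewrite {2}(divn_eq k l).
under eq_bigr => i _ do rewrite {1}(divn_eq k l) addnC addnA addnC addnA.
have ml : (k %% l < l)%N by rewrite ltn_mod.
transitivity (\sum_(i < l) (k %/ l + (i < k %% l)))%N.
  apply: eq_bigr => i _; rewrite -ceil_div_small // -ceil_divD.
  by congr (_ %/ _)%N; lia.
rewrite big_split /= sum_nat_const card_ord mulnC; congr addn.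
rewrite -big_mkcond /= -(big_ord_widen _ (fun=> 1%N) (ltnW ml)).
by rewrite sum_nat_const card_ord muln1.
Qed.

Lemma Riordan_colD g f k j :
  Riordan_col g f (k + j * l) = (\prod_(i < l) f i) ^+ j * Riordan_col g f k.
Proof.
rewrite /Riordan_col mulrCA -prodrXl -big_split /=; congr (_ * _).
by apply: eq_bigr => i _; rewrite ceil_divD exprD.
Qed.

Lemma Riordan_col_small g f m : (m < l)%N ->
  Riordan_col g f m = g * \prod_(i < l | (i < m)%N) f i.
Proof.
move=> ml; rewrite /Riordan_col [in RHS]big_mkcond; congr (_ * _).
by apply: eq_bigr => i _; rewrite ceil_div_small //; case: ifP.
Qed.

(** Holds because the exponents sum to [k]. The case [c = t] gives the order of a column, and
    [c = t^(l-1)] serves the compression. *)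
Lemma Riordan_colZ g f c k :
  Riordan_col g (fun i => c * f i) k = c ^+ k * Riordan_col g f k.
Proof.
rewrite /Riordan_col mulrCA -{2}(sum_ceil_div k) -prodrXr -big_split /=; congr (_ * _).
by apply: eq_bigr => i _; rewrite exprMn.
Qed.

Lemma Riordan_col_shift g f k : (forall i, f i 0%N = 0) ->
  Riordan_col g f k = fpsX ^+ k * Riordan_col g (fun i => fps_shift (f i)) k.
Proof.
move=> f0; rewrite -Riordan_colZ /Riordan_col; congr (_ * _).
by apply: eq_bigr => i _; rewrite -fps_shiftE.
Qed.

Lemma Riordan_col_lead0 g f k : (forall i, f i 0%N = 0) ->
  fps_lead0 k (Riordan_col g f k).
Proof. by move=> f0; rewrite Riordan_col_shift //; apply: fpsXn_lead0. Qed.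

Lemma Riordan_col_lead_coef g f k : (forall i, f i 0%N = 0) ->
  Riordan_col g f k k = g 0%N * \prod_(i < l) f i 1%N ^+ ((k + l - i.+1) %/ l).
Proof.
move=> f0; rewrite Riordan_col_shift // fpsXnME leqnn subnn fpsM0E fps_prod0E.
by congr (_ * _); apply: eq_bigr => i _; rewrite fps_exp0E.
Qed.

Lemma Riordan_col_neq0 g f k : (forall i, f i 0%N = 0) ->
  g 0%N != 0 -> (forall i, f i 1%N != 0) -> Riordan_col g f k != 0.
Proof.
move=> f0 g0 f1; apply/eqP => /fpsP/(_ k)/eqP; apply/negP.
rewrite Riordan_col_lead_coef // mulf_neq0 //.
by apply/prodf_neq0 => i _; rewrite expf_neq0.
Qed.

Lemma fps_dilate_Riordan_col g f k :
  fps_dilate l (Riordan_col g f k)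
  = Riordan_col (fps_dilate l g) (fun i => fps_dilate l (f i)) k.
Proof.
rewrite /Riordan_col fps_dilateM // fps_dilate_prod //; congr (_ * _).
by apply: eq_bigr => i _; rewrite fps_dilateX.
Qed.

End Column.

(** * The compressed array, its recurrences and the functional equations *)

Section Compression.
Variables (K : fieldType) (l : nat) (g : fps K) (f : 'I_l -> fps K).
Hypotheses (l_gt1 : (1 < l)%N) (Rgf : multiple_Riordan g f).

Let l_gt0 : (0 < l)%N := ltnW l_gt1.
Let hf i := hat_f l (f i).
Let H := \prod_(i < l) hf i.
Let col k := Riordan_col (hat_g l g) hf k.
Let Gb (b : nat -> K) := subst_root l (lgf l b).

Lemma hat_f0 i : hf i 0%N = 0. Proof. by []. Qed.

Lemma hat_f1 i : hf i 1%N = f i 1%N. Proof. by rewrite /= mul0n. Qed.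

Lemma Riordan_f0 i : f i 0%N = 0.
Proof.
by case: Rgf => _ _ /(_ i)[h _]; apply: h; rewrite mod0n modn_small.
Qed.

Lemma hat_col_neq0 k : col k != 0.
Proof.
case: Rgf => _ g0 f1; apply: Riordan_col_neq0 => // i.
by rewrite hat_f1; case: (f1 i).
Qed.

Lemma Riordan_entry_gt n k : (n < k)%N -> Riordan_entry g f n k = 0.
Proof. by move=> nk; apply: (Riordan_col_lead0 l_gt0 _ Riordan_f0 nk). Qed.

(** Dilation turns the compressed column into [t^((l-1) k)] times column [k] of the original array;
    the coefficients of [t^(n l)] are then compared. *)
Lemma compressionE n k : compression l (Riordan_entry g f) n k = col k n.
Proof.
(* For [k > n] the default 0 agrees with [col k] having order at least [k]. *)
rewrite /compression; case: leqP => kn; last by rewrite /col Riordan_col_lead0.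
transitivity (fps_dilate l (col k) (n * l)%N); last by rewrite /= dvdn_mull // mulnK.
case: Rgf => gl _ fl.
have -> : fps_dilate l (col k) = fpsX ^+ ((l - 1) * k) * Riordan_col g f k.
  rewrite exprM -Riordan_colZ // fps_dilate_Riordan_col // hat_gE //.
  by congr (_ * _); apply: eq_bigr => i _; rewrite hat_fE //; case: (fl i).
by rewrite fpsXnME ifT //; nia.
Qed.

(** The quotient [H / t^(l-1)], written without division. *)
Definition hat_radicand : fps K :=
  fpsX * \prod_(i < l) fps_shift (hf i).

Lemma hat_radicand0 : hat_radicand 0%N = 0.
Proof. by rewrite fpsM0E mul0r. Qed.

Lemma hat_radicandE : fpsX ^+ (l - 1) * hat_radicand = H.
Proof.
rewrite /H (eq_bigr _ (fun i _ => fps_shiftE (hat_f0 i))) big_split /=.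
rewrite prodr_const card_ord -{2}(subnK l_gt0) addn1 exprSr /hat_radicand; ring.
Qed.

Lemma sum_colD b k n :
  \sum_(j \in [set: nat]) b j * col (k + j * l)%N (n + j * (l - 1))%N
  = (Gb b hat_radicand * col k) n.
Proof.
rewrite subst_root_mulE ?hat_radicand0 //; apply: eq_fsbigr => j _; congr (_ * _).
(* The row offset [j * (l - 1)] cancels exactly the power of [t] by which [H ^+ j] exceeds
   [hat_radicand ^+ j]. *)
rewrite /col Riordan_colD // -/H -hat_radicandE exprMn -exprM -mulrA fpsXnME.
by rewrite mulnC ifT ?addnK // leq_addl.
Qed.

Lemma A_recurrenceP b :
  (forall n k, (l <= k)%N -> (k <= n)%N ->
     col k n = \sum_(j \in [set: nat])
       b j * col (k + j * l - l)%N (n - l + j * (l - 1))%N)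
  <-> Gb b hat_radicand * fpsX ^+ l = H.
Proof.
have sumE n k : (\sum_(j \in [set: nat])
    b j * col (k + l + j * l - l)%N (n - l + j * (l - 1))%N)
    = (Gb b hat_radicand * col k) (n - l)%N.
  by rewrite -sum_colD; apply: eq_fsbigr => j _; rewrite addnAC addnK.
have colS k : col (k + l)%N = H * col k.
  by have := Riordan_colD l_gt0 (hat_g l g) hf k 1; rewrite mul1n expr1.
split=> [rec|e n k lk kn].
  (* The recurrence for the single column [l] suffices: that column is [H * col 0], and [col 0]
     cancels. *)
  apply: (mulIf (hat_col_neq0 0)); rewrite mulrAC mulrC -colS.
  apply/fpsP => n; rewrite fpsXnME; case: leqP => ln.
    by rewrite rec // sumE.
  (* The recurrence is silent on rows [n < l], but there both sides vanish. *)
  by rewrite /col Riordan_col_lead0.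
have ln := leq_trans lk kn; rewrite -(subnK lk) sumE colS -e.
by rewrite mulrAC mulrC fpsXnME ln.
Qed.

Lemma Z_recurrenceP b m :
  (forall n, (m < n)%N ->
     col m n = \sum_(j \in [set: nat])
       b j * col (m + j * l)%N (n - 1 + j * (l - 1))%N)
  <-> Gb b hat_radicand * (fpsX * col m) = col m - fpsC (col m m) * fpsX ^+ m.
Proof.
have tE n : (Gb b hat_radicand * (fpsX * col m)) n
    = if (0 < n)%N then (Gb b hat_radicand * col m) (n - 1)%N else 0.
  by rewrite mulrCA -[fpsX]expr1 fpsXnME.
(* The recurrence covers only rows [n > m]. In the other rows the left side vanishes since
   [fpsX * col m] has order at least [m + 1], and removing the leading term of [col m] makes the
   right side vanish too. *)
have low n : (n <= m)%N -> (Gb b hat_radicand * (fpsX * col m)) n = 0.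
  move=> nm; have := @fps_lead0M _ 0 m.+1 (Gb b hat_radicand) (fpsX * col m).
  apply=> //; rewrite /col Riordan_col_shift // mulrA -exprS; exact: fpsXn_lead0.
split=> [rec|e n mn].
  apply/fpsP => n; rewrite fpsDE fpsNE fpsCXnE.
  case: ltngtP => [nm|mn|->].
  - by rewrite low ?(ltnW nm) // /col Riordan_col_lead0 // subrr.
  - by rewrite tE (leq_ltn_trans _ mn) // -sum_colD -rec // subr0.
  - by rewrite low // subrr.
rewrite sum_colD; have := tE n; rewrite (leq_ltn_trans _ mn) // => <-.
by rewrite e fpsDE fpsNE fpsCXnE gtn_eqF // subr0.
Qed.

Lemma compression_recurrencesP b w :
  compression_recurrences g f b w <->
  Gb b hat_radicand * fpsX ^+ l = H
  /\ forall m, (m < l)%N ->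
       Gb (w m) hat_radicand * (fpsX * col m) = col m - fpsC (col m m) * fpsX ^+ m.
Proof.
rewrite /compression_recurrences /=; split=> -[hA hZ]; split.
- apply/A_recurrenceP => n k lk kn; rewrite -compressionE hA //.
  by apply: eq_fsbigr => j _; rewrite compressionE.
- move=> m ml; apply/Z_recurrenceP => n mn; rewrite -compressionE hZ //.
  by apply: eq_fsbigr => j _; rewrite compressionE.
- move=> n k lk kn; rewrite compressionE ((A_recurrenceP b).2 hA) //.
  by apply: eq_fsbigr => j _; rewrite compressionE.
- move=> m n ml mn; rewrite compressionE ((Z_recurrenceP (w m) m).2 (hZ m ml)) //.
  by apply: eq_fsbigr => j _; rewrite compressionE.
Qed.

(** For [m < l] the denominator is [col m] and the constant in the numerator is its leading
    coefficient, so only denominators remain to be cleared. *)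
Lemma Z_identityP m S : (m < l)%N ->
  S%:F = fpsX%:F^-1 * (1 - (fpsC (g 0%N * \prod_(i < l | (i < m)%N) f i 1%N))%:F
           * fpsX%:F ^+ m
           / ((hat_g l g)%:F * \prod_(i < l | (i < m)%N) (hat_f l (f i))%:F))
  <-> S * (fpsX * col m) = col m - fpsC (col m m) * fpsX ^+ m.
Proof.
move=> ml; have X0 := fpsX_neq0 K; have C0 := hat_col_neq0 m.
rewrite -rmorph_prod -tofracM -Riordan_col_small // -/hf -/(col m).
have -> : g 0%N * \prod_(i < l | (i < m)%N) f i 1%N = col m m.
  rewrite /col Riordan_col_lead_coef //; congr (_ * _).
  rewrite big_mkcond; apply: eq_bigr => i _.
  by rewrite ceil_div_small // hat_f1; case: ifP.
by rewrite -tofracXn -tofracM; apply: tofrac_eq_mulV_subr_div.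
Qed.

(** Uniqueness here lets the existential witness in [gf_identities] be replaced by
    [hat_radicand]. *)
Lemma hat_radicandP X :
  X%:F = (\prod_(i < l) (hf i)%:F) / fpsX%:F ^+ (l - 1) <-> X = hat_radicand.
Proof.
rewrite -rmorph_prod -tofracXn tofrac_eq_div ?expf_neq0 ?fpsX_neq0 //.
rewrite -/H -hat_radicandE mulrC; split=> [|->//].
by apply: mulfI; rewrite expf_neq0 ?fpsX_neq0.
Qed.

Lemma gf_identitiesP b w :
  gf_identities g f b w <-> compression_recurrences g f b w.
Proof.
rewrite compression_recurrencesP.
(* The identity for [Z_0] is the case [m = 0], where the products are empty. *)
have Z0 S : S%:F = fpsX%:F^-1 * (1 - (fpsC (g 0%N))%:F / (hat_g l g)%:F) <->
    S * (fpsX * col 0) = col 0 - fpsC (col 0 0) * fpsX ^+ 0.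
  by rewrite -Z_identityP // !big_pred0 // !mulr1.
have AP S : S%:F = (\prod_(i < l) (hf i)%:F) / fpsX%:F ^+ l <-> S * fpsX ^+ l = H.
  by rewrite -rmorph_prod -tofracXn tofrac_eq_div ?expf_neq0 ?fpsX_neq0.
split=> [[X [_ /hat_radicandP -> /AP hA /Z0 h0 hZ]]|[hA hZ]].
  split=> // -[_ //|m ml]; apply/Z_identityP => //; exact: hZ.
exists hat_radicand; split; first exact: hat_radicand0.
- exact/hat_radicandP.
- exact/AP.
- by apply/Z0/hZ.
- by move=> m /andP[_ ml]; apply/Z_identityP => //; apply: hZ.
Qed.

Lemma compression_recurrences_of_sequences a z :
  A_sequence l (Riordan_entry g f) a ->
  (forall m, (m < l)%N -> Z_sequence l (Riordan_entry g f) m (z m)) ->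
  compression_recurrences g f a z.
Proof.
move=> ha hz; split=> [n k lk kn|m n ml mn].
  (* From [l <= k <= n], the row [n l - (l-1) k] is at least [k], hence at least [l]. *)
  rewrite {1}/compression kn ha //; last by nia.
  apply: eq_fsbigr => j _; congr (_ * _); rewrite /compression; case: leqP => kjn.
    by congr (Riordan_entry _ _ _ _); nia.
  (* Where the compression is 0 by default, the original entry also lies above the diagonal. *)
  by apply: Riordan_entry_gt; nia.
rewrite {1}/compression ltnW // hz //; last by nia.
(* From [m < n], the row [n l - (l-1) m] is at least [l + m], so the guard against negative rows is
   always met. *)
apply: eq_fsbigr => j _; congr (_ * _); rewrite ifT; last by nia.
rewrite /compression; case: leqP => mjn.
  by congr (Riordan_entry _ _ _ _); nia.
by apply: Riordan_entry_gt; nia.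
Qed.

End Compression.

Theorem theorem6p3 (K : fieldType) (charK : [pchar K] =i pred0)
    (l : nat) (l_ge2 : (2 <= l)%N)
    (g : fps K) (f : 'I_l -> fps K) (Rgf : multiple_Riordan g f)
    (a : nat -> K) (z : nat -> nat -> K)
    (ha : A_sequence l (Riordan_entry g f) a)
    (hz : forall m, (m < l)%N -> Z_sequence l (Riordan_entry g f) m (z m)) :
  [/\ gf_identities g f a z,
      compression_recurrences g f a z
    & forall (b : nat -> K) (w : nat -> nat -> K),
        gf_identities g f b w <-> compression_recurrences g f b w].
Proof.
have rec := compression_recurrences_of_sequences l_ge2 Rgf ha hz.
by split=> [|//|b w]; [apply/gf_identitiesP | apply: gf_identitiesP].
Qed.
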